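(* Let $H$ be a graph whose Seidel matrix $S(H)$ has smallest eigenvalue at least $-5$, and let $B=\{b_1,\dots,b_5\}$ be a maximum clique of $H$. Assume that the pillar $P_{B,\{b_1,b_2\}}$ is isomorphic to $mK_2$ for some integer $m$, and assume one of the following: (I) the pillar $P_{B,\{b_1\}}$ has two non-adjacent vertices; (II) both pillars $P_{B,\{b_1\}}$ and $P_{B,\{b_2\}}$ have at least one vertex. If the pillar $P_{B,\{b_3,b_4\}}$ contains at least one edge, then $m\leq 8$.
   Context: Graphs are finite, simple and undirected. For a graph $H$ with adjacency matrix $A(H)$, the Seidel matrix is $S(H)=J-I-2A(H)$, with $J$ the all-ones matrix; its eigenvalues are the Seidel eigenvalues of $H$. A maximum clique is a clique of largest possible order in $H$. $N(x)$ denotes the set of neighbours of $x$. For a maximum clique $B$ and a subset $W\subseteq B$, the pillar $P_{B,W}$ is the induced subgraph of $H$ on $\{x\in V(H)\setminus B : N(x)\cap B = W\}$. $mK_2$ denotes the disjoint union of $m$ copies of $K_2$. *)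

(* Defs.v *)
From HB Require Import structures.
From mathcomp Require Import all_boot all_order all_algebra.
Set Implicit Arguments. Unset Strict Implicit. Unset Printing Implicit Defensive.
Import Order.TTheory GRing.Theory Num.Theory.
Local Open Scope ring_scope.

Record sgraph := SGraph {
  vertex :> finType;
  adj : rel vertex;
  adj_sym : symmetric adj;
  adj_irr : irreflexive adj }.

Definition neighbours (H : sgraph) (x : H) : {set H} := [set y | adj x y].

Definition isomorphic (G H : sgraph) : Prop :=
  exists2 f : G -> H, bijective f & forall x y, adj (f x) (f y) = adj x y.

Section Induced.
Variables (H : sgraph) (A : {set H}).

Definition induced_adj : rel {x : H | x \in A} := fun x y => adj (val x) (val y).

Fact induced_adj_sym : symmetric induced_adj.
Proof. by move=> x y; exact: adj_sym. Qed.

Fact induced_adj_irr : irreflexive induced_adj.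
Proof. by move=> x; exact: adj_irr. Qed.

Definition induced : sgraph := SGraph induced_adj_sym induced_adj_irr.
End Induced.

Section MatchingGraph.
Variable m : nat.

(* The i-th copy of K_2 has the vertices (i, false) and (i, true). *)
Definition mK2_adj : rel ('I_m * bool)%type :=
  fun u v => (u.1 == v.1) && (u.2 != v.2).

Fact mK2_adj_sym : symmetric mK2_adj.
Proof. by move=> u v; rewrite /mK2_adj eq_sym [u.2 == _]eq_sym. Qed.

Fact mK2_adj_irr : irreflexive mK2_adj.
Proof. by move=> u; rewrite /mK2_adj !eqxx. Qed.

Definition mK2 : sgraph := SGraph mK2_adj_sym mK2_adj_irr.
End MatchingGraph.

Definition clique (H : sgraph) (B : {set H}) : Prop :=
  {in B &, forall x y, x != y -> adj x y}.

Definition maximum_clique (H : sgraph) (B : {set H}) : Prop :=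
  clique B /\ forall C : {set H}, clique C -> (#|C| <= #|B|)%N.

Definition pillar (H : sgraph) (B W : {set H}) : sgraph :=
  induced [set x | (x \notin B) && (neighbours x :&: B == W)].

Definition adjacency_mx (R : pzRingType) (H : sgraph) : 'M[R]_#|H| :=
  \matrix_(i, j) (adj (enum_val i) (enum_val j))%:R.

Definition seidel_mx (R : pzRingType) (H : sgraph) : 'M[R]_#|H| :=
  const_mx 1 - 1%:M - 2%:R *: adjacency_mx R H.

Definition smallest_eigenvalue (R : realFieldType) n (M : 'M[R]_n) (lam : R) :
  Prop :=
  eigenvalue M lam /\ forall mu : R, eigenvalue M mu -> lam <= mu.

(* Main.v *)
(* [S + 5 I] is positive semidefinite, so it is a Gram matrix: vertices become
   vectors of squared norm 5 with inner product -1 (adjacent) or 1 (non-adjacent).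
   Project them orthogonally to [B]. The edges of the pillar on {b1, b2} become
   m pairwise orthogonal planes, each carrying a "star" u, w, -(u + w) of vectors
   of squared norm 4 at mutual angle 120 degrees; the edge of the pillar on
   {b3, b4} becomes two vectors y, y' of squared norm 4 whose projection to every
   plane has squared norm at least 4/9. If m >= 9, then y and y' are thirds of
   sums of star legs, one leg t_i, t'_i per plane, and <y, y'> = -2 forces
   t_i <> t'_i everywhere. A vector z of the pillar on {b1} then must be
   non-orthogonal to two planes, and these exhaust its squared norm 8/3: z is
   a combination with nonpositive coefficients of vectors u_i, w_i. Hence <z, z'> >= 0
   for every other z' of the pillars on {b1} or {b2}, whereas (I) and (II) give
   <z, z'> < 0. *)
Require Import Defs.
From HB Require Import structures.
From mathcomp Require Import all_boot all_order all_algebra.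
From mathcomp Require Import sesquilinear spectral complex ring lra.
Set Implicit Arguments. Unset Strict Implicit. Unset Printing Implicit Defensive.
Import Order.TTheory GRing.Theory Num.Theory.
Local Open Scope ring_scope.

(** * Positivity of a real symmetric matrix from its eigenvalues *)

Section SpectralBound.
Local Open Scope sesquilinear_scope.
Local Open Scope complex_scope.

Lemma spectral_diag_eigenvalue (C : numClosedFieldType) n (A : 'M[C]_n) i :
  A \is normalmx -> eigenvalue A (spectral_diag A 0 i).
Proof.
move=> /orthomx_spectralP AE; have Pu := spectral_unit A.
apply/eigenvalueP; exists (row i (spectralmx A)).
  rewrite -row_mul {2}AE !mulmxA mulmxV // mul1mx mul_diag_mx.
  by apply/rowP=> j; rewrite !mxE.
by rewrite rowE mulmx_free_eq0 ?row_free_unit //; apply/eqP => /matrixP /(_ 0 i);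
  rewrite !mxE !eqxx => /eqP; rewrite oner_eq0.
Qed.

(** Over [R[i]] the matrix is Hermitian, hence unitarily diagonalizable with real diagonal [d]. In
    the new coordinates [w] the form is the sum of the [d i * |w i|^2], and every [d i] is an
    eigenvalue of [A]. *)
Lemma symmetric_psd (R : rcfType) n (A : 'M[R]_n) (v : 'rV[R]_n) :
    A^T = A -> (forall mu, eigenvalue A mu -> 0 <= mu) ->
  0 <= (v *m A *m v^T) 0 0.
Proof.
move=> Asym Apos; pose AC := map_mx (real_complex R) A.
have ACreal : AC \is a realmx.
  by apply/mxOverP => i j; rewrite mxE; apply/complex_realP; exists (A i j).
have ACsym : AC \is symmetricmx.
  by apply/is_hermitianmxP; rewrite expr0 scale1r map_mx_id // /AC map_trmx Asym.
have AChermi := realsym_hermsym ACsym ACreal.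
have ACnormal := hermitian_normalmx AChermi.
pose P := spectralmx AC; pose d := spectral_diag AC.
have d_ge0 i : 0 <= d 0 i.
  have /complex_realP [k dk] := mxOverP (hermitian_spectral_diag_real AChermi) 0 i.
  have := spectral_diag_eigenvalue i ACnormal.
  by rewrite /d dk eigenvalue_map => /Apos; rewrite lecR.
pose vC := map_mx (real_complex R) v; pose w := vC *m P^t*.
suff E : real_complex R ((v *m A *m v^T) 0 0) = \sum_i d 0 i * (w 0 i * (w 0 i)^*%C).
  rewrite -lecR E; apply: sumr_ge0 => i _.
  by rewrite mulr_ge0 ?mulcJ_ge0.
have -> : real_complex R ((v *m A *m v^T) 0 0) = (vC *m AC *m vC^T) 0 0.
  by rewrite /vC map_trmx -!map_mxM [RHS]mxE.
have wE : P *m vC^T = w^t*.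
  rewrite /w trmx_mul map_mxM trmxCK.
  by congr (_ *m _); apply/matrixP => i j; rewrite !mxE; apply/esym/CrealP/complex_realP;
    exists (v j i).
have ACE : AC = P^t* *m diag_mx d *m P.
  by rewrite -invmx_unitary ?spectral_unitarymx //; apply/orthomx_spectralP.
rewrite {1}ACE !mulmxA -/w -mulmxA wE mul_mx_diag mxE.
by apply: eq_bigr => i _; rewrite !mxE mulrCA mulrA.
Qed.

End SpectralBound.

(** * Semidefinite bilinear forms *)

Section PositiveForm.
Variables (R : realFieldType) (n : nat) (G : 'M[R]_n).
Hypothesis G_sym : G^T = G.
Hypothesis G_psd : forall v : 'rV[R]_n, 0 <= (v *m G *m v^T) 0 0.
Implicit Types u v w : 'rV[R]_n.

Definition gram u v := (u *m G *m v^T) 0 0.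
Local Notation "<[ u , v ]>" := (gram u v).

Lemma gramC u v : <[u, v]> = <[v, u]>.
Proof.
have -> : <[u, v]> = ((u *m G *m v^T)^T) 0 0 by rewrite mxE.
by rewrite !trmx_mul trmxK G_sym mulmxA.
Qed.

Lemma gramDl u v w : <[u + v, w]> = <[u, w]> + <[v, w]>.
Proof. by rewrite /gram !mulmxDl mxE. Qed.

Lemma gramZl a u v : <[a *: u, v]> = a * <[u, v]>.
Proof. by rewrite /gram -!scalemxAl mxE. Qed.

Lemma gramNl u v : <[- u, v]> = - <[u, v]>.
Proof. by rewrite -scaleN1r gramZl mulN1r. Qed.

Lemma gramDr u v w : <[w, u + v]> = <[w, u]> + <[w, v]>.
Proof. by rewrite gramC gramDl !(gramC w). Qed.

Lemma gramZr a u v : <[u, a *: v]> = a * <[u, v]>.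
Proof. by rewrite gramC gramZl gramC. Qed.

Lemma gramNr u v : <[u, - v]> = - <[u, v]>.
Proof. by rewrite gramC gramNl gramC. Qed.

Lemma gram_suml (I : finType) (F : I -> 'rV_n) v :
  <[\sum_i F i, v]> = \sum_i <[F i, v]>.
Proof. by rewrite /gram !mulmx_suml summxE. Qed.

Lemma gram_sumr (I : finType) (F : I -> 'rV_n) v :
  <[v, \sum_i F i]> = \sum_i <[v, F i]>.
Proof. by rewrite gramC gram_suml; apply: eq_bigr => i _; rewrite gramC. Qed.

Let gramE := (gramDl, gramDr, gramNl, gramNr, gramZl, gramZr).

(** The form may be degenerate, so a vector of norm 0 need not vanish. This lemma replaces equality
    of vectors by equality of their inner products. *)
Lemma gram_isotropic v w : <[v, v]> <= 0 -> <[v, w]> = 0.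
Proof.
move=> v_le0; have v0 : <[v, v]> = 0 by apply/le_anti; rewrite v_le0 G_psd.
apply/eqP; apply: contraT => a_neq0.
(* As [v] is isotropic, [t *: v + w] has squared norm [2 t a + c]; this [t] makes it -1. *)
have := G_psd ((- (<[w, w]> + 1) / (2 * <[v, w]>)) *: v + w).
rewrite -/(gram _ _) !gramE v0 (gramC w v) -!mulrA.
set c := <[w, w]>; set a := <[v, w]> in a_neq0 *.
have -> : - (c + 1) * ((2 * a)^-1 * (- (c + 1) * ((2 * a)^-1 * 0))) +
   - (c + 1) * ((2 * a)^-1 * a) + (- (c + 1) * ((2 * a)^-1 * a) + c) = -1.
  by field.
by rewrite ler0N1.
Qed.

(* The vectors [T i / 3] are orthogonal projections of [y] of squared norm 4/9,
   so nine of them exhaust the squared norm 4 of [y]. *)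
Lemma gram_nine_expansion (T : 'I_9 -> 'rV_n) y v :
    (forall i, <[T i, T i]> = 4) ->
    (forall i j, i != j -> <[T i, T j]> = 0) ->
    <[y, y]> = 4 -> (forall i, <[y, T i]> = 4 / 3) ->
  <[y, v]> = 3^-1 * \sum_i <[T i, v]>.
Proof.
move=> T4 T0 y4 yT; rewrite -gram_suml; set S := \sum_i T i.
have yS : <[y, S]> = 12.
  rewrite gram_sumr (eq_bigr (fun=> 4 / 3)) // sumr_const card_ord -mulr_natr.
  by lra.
have SS : <[S, S]> = 36.
  rewrite gram_suml (eq_bigr (fun=> 4)); last first.
    move=> i _; rewrite gram_sumr (bigD1 i) //= T4 big1 ?addr0 // => j ji.
    by rewrite T0 // eq_sym.
  by rewrite sumr_const card_ord -mulr_natr; lra.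
have : <[y - 3^-1 *: S, v]> = 0.
  by apply: gram_isotropic; rewrite !gramE (gramC S) yS SS y4; lra.
by rewrite !gramE => /eqP; rewrite subr_eq0 => /eqP.
Qed.

(** * Contradiction from nine orthogonal planes *)

Lemma nine_planes (U W : 'I_9 -> 'rV[R]_n) (y y' z z' : 'rV[R]_n) :
    (forall i, <[U i, U i]> = 4) -> (forall i, <[W i, W i]> = 4) ->
    (forall i, <[U i, W i]> = -2) ->
    (forall i j, i != j -> [/\ <[U i, U j]> = 0, <[W i, W j]> = 0
                            & <[U i, W j]> = 0]) ->
    <[y, y]> = 4 -> <[y', y']> = 4 -> <[y, y']> = -2 ->
    <[z, z]> = 8 / 3 -> <[z, z']> < 0 ->
    {in [:: y; y'], forall x i, <[x, U i]> \in [:: -(2 / 3); 4 / 3] /\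
                                <[x, W i]> \in [:: -(2 / 3); 4 / 3]} ->
    {in [:: z; z'], forall x i, <[x, U i]> \in [:: -2; 0] /\
                                <[x, W i]> \in [:: -2; 0]} ->
    {in [:: y; y'], forall x, <[z, x]> \in [:: -(4 / 3); 2 / 3]} ->
  False.
Proof.
move=> U4 W4 UW orth y4 y'4 yy' z83 zz' yUW zUW zy.
(* The three legs sum to 0, so if [U i] and [W i] both give -2/3, the third leg gives 4/3. Otherwise
   one of [U i], [W i] already does. *)
have legs x : x \in [:: y; y'] -> exists T : 'I_9 -> 'rV[R]_n, forall i,
    <[x, T i]> = 4 / 3 /\ [\/ T i = U i, T i = W i | T i = - (U i + W i)].
  move=> xy; apply: (fin_all_exists (P := fun i t => <[x, t]> = 4 / 3 /\
    [\/ t = U i, t = W i | t = - (U i + W i)])) => i.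
  have [] := yUW x xy i; rewrite !inE => /orP[]/eqP xU /orP[]/eqP xW.
  - exists (- (U i + W i)); split; last by constructor 3.
    by rewrite !gramE xU xW; lra.
  - by exists (W i); split => //; constructor 2.
  - by exists (U i); split => //; constructor 1.
  - by exists (U i); split => //; constructor 1.
have [T TE] := legs y (mem_head _ _).
have [T' T'E] : exists T' : 'I_9 -> 'rV[R]_n, forall i,
    <[y', T' i]> = 4 / 3 /\ [\/ T' i = U i, T' i = W i | T' i = - (U i + W i)].
  by apply: legs; rewrite !inE eqxx orbT.
have gramWU i j : i != j -> <[W i, U j]> = 0.
  by move=> ij; rewrite gramC; have [|_ _ ->] // := orth j i; rewrite eq_sym.
have leg_orth t t' i j : i != j ->
    [\/ t = U i, t = W i | t = - (U i + W i)] ->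
    [\/ t' = U j, t' = W j | t' = - (U j + W j)] -> <[t, t']> = 0.
  move=> ij; have [UU WW UWij] := orth i j ij.
  by case=> -> [] ->; rewrite ?gramE ?UU ?WW ?UWij ?(gramWU i j) //; lra.
have leg_gram t t' i :
    [\/ t = U i, t = W i | t = - (U i + W i)] ->
    [\/ t' = U i, t' = W i | t' = - (U i + W i)] ->
    <[t, t']> = 4 /\ t = t' \/ <[t, t']> = -2.
  by case=> -> [] ->; rewrite ?gramE ?(gramC (W i) (U i)) ?U4 ?W4 ?UW;
     (try by left; split=> //; lra); right; lra.
have leg4 t i : [\/ t = U i, t = W i | t = - (U i + W i)] -> <[t, t]> = 4.
  by case=> ->; rewrite ?gramE ?(gramC (W i) (U i)) ?U4 ?W4 ?UW; lra.
have yE v : <[y, v]> = 3^-1 * \sum_i <[T i, v]>.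
  apply: gram_nine_expansion => // [i|i j ij|i]; last by have [] := TE i.
    by have [_ /leg4] := TE i.
  by have [_ Ti] := TE i; have [_ Tj] := TE j; apply: leg_orth Ti Tj.
have y'E v : <[y', v]> = 3^-1 * \sum_i <[T' i, v]>.
  apply: gram_nine_expansion => // [i|i j ij|i]; last by have [] := T'E i.
    by have [_ /leg4] := T'E i.
  by have [_ Ti] := T'E i; have [_ Tj] := T'E j; apply: leg_orth Ti Tj.
(* Expanding both [y] and [y'] kills the terms across distinct planes and leaves a factor 1/9. *)
have sumTT' : \sum_i <[T i, T' i]> = -18.
  suff E : <[y, y']> = 9^-1 * \sum_i <[T i, T' i]> by move: yy'; rewrite E; lra.
  rewrite yE (_ : 9^-1 = 3^-1 * 3^-1); last by lra.
  rewrite -mulrA; congr (_ * _); rewrite mulr_sumr; apply: eq_bigr => i _.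
  rewrite gramC y'E (bigD1 i) //= big1 ?addr0 1?gramC // => j ji.
  by have [_ Ti] := TE i; have [_ Tj] := T'E j; apply: leg_orth Tj Ti.
(* Each term is at least -2, so a single term 4 would give a sum of at least 4 - 16 = -12. *)
have TT' i : T i <> T' i.
  move=> E; have : \sum_(j | j != i) (-2 : R) <= \sum_(j | j != i) <[T j, T' j]>.
    apply: ler_sum => j _; have [_ Tj] := TE j; have [_ T'j] := T'E j.
    by have [[-> _]|->] := leg_gram _ _ _ Tj T'j; lra.
  rewrite sumr_const (eq_card (B := predC1 i)) // cardC1 card_ord -mulr_natr.
  move: sumTT'; rewrite (bigD1 i) //= -E; have [_ /leg4 ->] := TE i.
  by lra.
pose act i := (<[z, U i]> != 0) || (<[z, W i]> != 0).
have zlegN t i : [\/ t = U i, t = W i | t = - (U i + W i)] -> ~~ act i ->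
    <[t, z]> = 0.
  rewrite negb_or !negbK (gramC t) => tE /andP[/eqP zU /eqP zW].
  by case: tE => ->; rewrite ?gramE ?zU ?zW //; lra.
(* This is the case where plane [i] alone contributes to the product of [z] with [y] or [y']. A
   third of the product is -2/3 or 0 on [U i] and [W i], and 0, 2/3 or 4/3 on the third leg: only
   2/3 is admissible. *)
have zleg2 t i : [\/ t = U i, t = W i | t = - (U i + W i)] ->
    3^-1 * <[t, z]> \in [:: -(4 / 3); 2 / 3] -> t = - (U i + W i).
  have [] := zUW z (mem_head _ _) i; rewrite !inE (gramC t).
  by move=> /orP[]/eqP zU /orP[]/eqP zW [->|->|->] //;
     rewrite ?gramE ?zU ?zW => /orP[]/eqP E; exfalso; lra.
have [i iact] : exists i, act i.
  apply/existsP; apply: contraT; rewrite negb_exists => /forallP act0.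
  have := zy y (mem_head _ _); rewrite gramC yE big1 => [|i _].
    by rewrite !inE => /orP[]/eqP; lra.
  by have [_ /zlegN ->] := TE i.
(* If [i] were the only active plane, [T i] and [T' i] would both be the third leg. *)
have [j ji jact] : exists2 j, j != i & act j.
  apply/exists_inP; apply: contraT; rewrite negb_exists_in => /forall_inP act0.
  have [_ Ti] := TE i; have [_ T'i] := T'E i.
  have := zy y (mem_head _ _); rewrite gramC yE (bigD1 i) //= big1 ?addr0.
    move=> /(zleg2 _ _ Ti) TiE.
    have := zy y'; rewrite [y' \in _]inE mem_head orbT => /(_ isT).
    rewrite gramC y'E (bigD1 i) //= big1 ?addr0.
      by move=> /(zleg2 _ _ T'i) T'iE; case: (TT' i); rewrite TiE T'iE.
    by move=> j ji; have [_ /zlegN ->] := T'E j; last exact: act0.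
  by move=> j ji; have [_ /zlegN ->] := TE j; last exact: act0.
(* On an active plane this is the projection of [z] when its products with [U k], [W k] are (0, -2)
   or (-2, 0). For (-2, -2) it is not, but the bound [zp] still holds. *)
pose p k := if <[z, U k]> == 0 then - 3^-1 *: (U k + 2 *: W k)
            else - 3^-1 *: (2 *: U k + W k).
have pp k : <[p k, p k]> = 4 / 3.
  by rewrite /p; case: ifP => _; rewrite !gramE (gramC (W k) (U k)) U4 W4 UW; lra.
have zp k : act k -> 4 / 3 <= <[z, p k]>.
  have [] := zUW z (mem_head _ _) k; rewrite /act /p !inE.
  by move=> /orP[]/eqP zU /orP[]/eqP zW; rewrite zU zW ?eqxx //=;
     case: eqP => // _; rewrite !gramE zU zW; lra.
have z'p k : 0 <= <[p k, z']>.
  have [] := zUW z' _ k; rewrite ?inE ?eqxx ?orbT // (gramC _ z') /p.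
  by move=> /orP[]/eqP zU /orP[]/eqP zW; case: ifP => _; rewrite !gramE zU zW; lra.
have pij : <[p i, p j]> = 0.
  have ij : i != j by rewrite eq_sym.
  have [UU WW UWij] := orth i j ij.
  by rewrite /p; do 2!case: ifP => _; rewrite !gramE UU WW UWij gramWU //; lra.
(* The squared norm is at most 8/3 - 2 (4/3 + 4/3) + 4/3 + 4/3 = 0. *)
have : <[z - p i - p j, z']> = 0.
  apply: gram_isotropic; have := zp i iact; have := zp j jact.
  by rewrite !gramE !(gramC _ z) (gramC (p j)) pij !pp z83; lra.
by have := z'p i; have := z'p j; rewrite !gramE; lra.
Qed.


(** * Projection orthogonal to the clique *)

Section CliqueResidual.
Variable b : 'I_5 -> 'rV[R]_n.
Hypothesis gram_b : forall i j, <[b i, b j]> = 6 * (i == j)%:R - 1.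

(* The Gram matrix [6 I - J] of the five vectors has inverse [(I + J) / 6], so
   this is the component of [v] orthogonal to all of them. *)
Definition clique_residual v :=
  v - \sum_i ((<[v, b i]> + \sum_j <[v, b j]>) / 6) *: b i.

Lemma clique_residual_orth v k : <[clique_residual v, b k]> = 0.
Proof.
rewrite !gramE gram_suml; set s := \sum_j <[v, b j]>.
have -> : \sum_i <[((<[v, b i]> + s) / 6) *: b i, b k]> = <[v, b k]>; last by lra.
pose c i := (<[v, b i]> + s) / 6.
(* The five coefficients add up to [(s + 5 s) / 6 = s]. *)
have -> : <[v, b k]> = 6 * c k - \sum_i c i.
  rewrite -mulr_suml big_split /= -/s sumr_const card_ord -mulr_natr /c.
  by field.
transitivity (\sum_i (6 * (c i * (i == k)%:R) - c i)).
  by apply: eq_bigr => i _; rewrite gramZl gram_b -/(c i); ring.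
rewrite sumrB -mulr_sumr (bigD1 k) //= eqxx big1 ?addr0 ?mulr1 // => i.
by move=> /negPf ->; rewrite mulr0.
Qed.

Lemma gram_clique_residual v w :
  <[clique_residual v, clique_residual w]> = <[v, w]>
    - (\sum_i <[v, b i]> * <[w, b i]>
       + (\sum_i <[v, b i]>) * (\sum_i <[w, b i]>)) / 6.
Proof.
rewrite {2}/clique_residual gramDr gramNr gram_sumr.
rewrite [X in _ - X]big1 => [|i _]; last by rewrite gramZr clique_residual_orth mulr0.
rewrite subr0 /clique_residual gramDl gramNl gram_suml; congr (_ - _).
set s := \sum_j <[v, b j]>; rewrite mulrDl mulr_sumr !mulr_suml -big_split /=.
by apply: eq_bigr => i _; rewrite gramZl (gramC (b i)); field.
Qed.

End CliqueResidual.
End PositiveForm.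

(** * The Gram matrix of the vertices *)

Section SeidelGram.
Variables (R : rcfType) (H : sgraph).
Local Notation G := (seidel_mx R H + 5%:M).

Definition vertex_vec (x : H) : 'rV[R]_#|H| := delta_mx 0 (enum_rank x).

Lemma seidel_shift_sym : G^T = G.
Proof.
apply/matrixP => i j; rewrite !mxE (eq_sym j i).
by rewrite [adj (enum_val j) _]adj_sym.
Qed.

Lemma seidel_shift_psd (lam : R) (v : 'rV[R]_#|H|) :
  smallest_eigenvalue (seidel_mx R H) lam -> - 5%:R <= lam ->
  0 <= (v *m G *m v^T) 0 0.
Proof.
move=> [_ lam_min] lam5; apply: symmetric_psd seidel_shift_sym _ => mu.
move=> /eigenvalueP [u uG u0].
suff /lam_min : eigenvalue (seidel_mx R H) (mu - 5) by lra.
apply/eigenvalueP; exists u => //; apply/eqP.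
by rewrite scalerBl eq_sym subr_eq -uG mulmxDr mul_mx_scalar.
Qed.

Lemma gram_vertex_vec x y : gram G (vertex_vec x) (vertex_vec y) =
  if x == y then 5 else if adj x y then -1 else 1.
Proof.
rewrite /gram /vertex_vec -rowE trmx_delta -colE !mxE !enum_rankK.
rewrite (inj_eq enum_rank_inj).
by case: eqP => [->|_]; rewrite ?adj_irr; [|case: adj]; rewrite /=; lra.
Qed.

Lemma pillarP (B W : {set H}) (x : pillar B W) :
  sval x \notin B /\ forall b, b \in B -> adj (sval x) b = (b \in W).
Proof.
case: x => x /=; rewrite inE => /andP[xB /eqP <-]; split=> // b bB.
by rewrite !inE bB andbT.
Qed.

End SeidelGram.

(** * Inner products of the pillar vectors, and conclusion *)

Theorem theorem4p1 (R : rcfType) (H : sgraph) (lam : R)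
  (hlam : smallest_eigenvalue (seidel_mx R H) lam)
  (hlam5 : - 5%:R <= lam)
  (b1 b2 b3 b4 b5 : H) (B : {set H})
  (hb : uniq [:: b1; b2; b3; b4; b5])
  (hB : B = [set b1; b2; b3; b4; b5])
  (hmax : maximum_clique B)
  (m : nat)
  (hm : isomorphic (pillar B [set b1; b2]) (mK2 m))
  (hcase :
    (exists x y : pillar B [set b1], x != y /\ ~~ adj x y) \/
    ((exists x : pillar B [set b1], True) /\
     (exists x : pillar B [set b2], True)))
  (hedge : exists x y : pillar B [set b3; b4], adj x y) :
  (m <= 8)%N.
Proof.
rewrite leqNgt; apply/negP => m9.
pose G := seidel_mx R H + 5%:M.
have G_sym : G^T = G := seidel_shift_sym R H.
have G_psd v : 0 <= (v *m G *m v^T) 0 0 := seidel_shift_psd v hlam hlam5.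
pose b := tnth [tuple b1; b2; b3; b4; b5].
have bB i : b i \in B.
  by rewrite hB !inE -!orbA; have := mem_tnth i [tuple b1; b2; b3; b4; b5];
     rewrite !inE.
have b_inj i j : (b i == b j) = (i == j) by rewrite /b !(tnth_nth b1) nth_uniq.
pose e (x : H) := vertex_vec R x.
have gram_b i j : gram G (e (b i)) (e (b j)) = 6 * (i == j)%:R - 1.
  rewrite /G gram_vertex_vec b_inj; case: eqP => [_|/eqP ij]; first by rewrite /=; lra.
  by rewrite (hmax.1 _ _ (bB i) (bB j)) ?b_inj //=; lra.
pose r x := clique_residual G (e \o b) (e x).
(* The list [s] records adjacency to the clique, with trailing [false] entries omitted thanks to the
   default of [nth]; [sgn s i] is then the inner product with the vector of [b i]. *)
pose pattern x (s : seq bool) := x \notin B /\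
  forall i : 'I_5, adj x (b i) = nth false s i.
pose sgn (s : seq bool) (i : 'I_5) : R := 1 - 2 * (nth false s i)%:R.
have gram_r x y s t : pattern x s -> pattern y t ->
    gram G (r x) (r y) = (if x == y then 5 else if adj x y then -1 else 1)
     - (\sum_i sgn s i * sgn t i + (\sum_i sgn s i) * (\sum_i sgn t i)) / 6.
  have gram_s z u i : pattern z u -> gram G (e z) (e (b i)) = sgn u i.
    move=> [zB zu]; rewrite /G gram_vertex_vec /sgn -zu.
    case: eqP zB => [->|_ _]; first by rewrite bB.
    by case: adj; rewrite /=; lra.
  move=> xs yt; rewrite (gram_clique_residual G_sym gram_b) -gram_vertex_vec.
  congr (_ - (_ + _ * _) / _); apply: eq_bigr => i _ /=;
    by rewrite ?(gram_s x s i xs) ?(gram_s y t i yt).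
have neq_pattern x y s t (i : 'I_5) : pattern x s -> pattern y t ->
    nth false s i != nth false t i -> x != y.
  by move=> [_ xs] [_ yt] st; apply: contraNneq st => xy; rewrite -xs -yt xy.
have patternP (W : {set H}) s : W \subset B ->
    (forall i : 'I_5, (b i \in W) = nth false s i) ->
    forall x : pillar B W, pattern (sval x) s.
  by move=> WB Ws x; have [xB xW] := pillarP x; split=> // i; rewrite xW ?Ws.
pose o0 := @Ordinal 5 0 isT; pose o1 := @Ordinal 5 1 isT.
pose o2 := @Ordinal 5 2 isT; pose o3 := @Ordinal 5 3 isT.
have pat12 : forall x : pillar B [set b1; b2], pattern (sval x) [:: true; true].
  apply: patternP => [|i]; rewrite -[b1]/(b o0) -[b2]/(b o1).
    by rewrite subUset !sub1set !bB.
  by rewrite !inE !b_inj; case: i => [[|[|[|[|[|]]]]] ?].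
have pat34 : forall x : pillar B [set b3; b4],
    pattern (sval x) [:: false; false; true; true].
  apply: patternP => [|i]; rewrite -[b3]/(b o2) -[b4]/(b o3).
    by rewrite subUset !sub1set !bB.
  by rewrite !inE !b_inj; case: i => [[|[|[|[|[|]]]]] ?].
have pat1 : forall x : pillar B [set b1], pattern (sval x) [:: true].
  apply: patternP => [|i]; rewrite -[b1]/(b o0); first by rewrite sub1set bB.
  by rewrite !inE !b_inj; case: i => [[|[|[|[|[|]]]]] ?].
have pat2 : forall x : pillar B [set b2], pattern (sval x) [:: false; true].
  apply: patternP => [|i]; rewrite -[b2]/(b o1); first by rewrite sub1set bB.
  by rewrite !inE !b_inj; case: i => [[|[|[|[|[|]]]]] ?].
have [f [g gK fK] f_adj] := hm.
(* The two ends, indexed by [c], of nine of the [m] edges. *)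
pose u (c : bool) (i : 'I_9) := sval (g (widen_ord m9 i, c)).
have u_pat c i : pattern (u c i) [:: true; true] by apply: pat12.
have u_adj c d i j : adj (u c i) (u d j) = (i == j) && (c != d).
  rewrite -[LHS]/(adj (g (widen_ord m9 i, c)) (g (widen_ord m9 j, d))).
  by rewrite -f_adj !fK.
have u_eq c d i j : (u c i == u d j) = (i == j) && (c == d).
  rewrite /u (inj_eq val_inj) (inj_eq (can_inj fK)) xpair_eqE.
  by rewrite -[_ == _ :> 'I_m]val_eqE.
have u_gram c d i j : gram G (r (u c i)) (r (u d j)) =
    if i == j then if c == d then 4 else -2 else 0.
  rewrite (gram_r _ _ _ _ (u_pat c i) (u_pat d j)) u_eq u_adj.
  rewrite /sgn !big_ord_recl !big_ord0 /=.
  by case: (i == j); case: (c == d); rewrite /=; lra.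
have [y [y' yy']] := hedge.
have y_gram c i (x : pillar B [set b3; b4]) :
    gram G (r (sval x)) (r (u c i)) \in [:: -(2 / 3); 4 / 3].
  have xu := neq_pattern _ _ _ _ o0 (pat34 x) (u_pat c i) isT.
  rewrite (gram_r _ _ _ _ (pat34 x) (u_pat c i)) (negPf xu).
  rewrite /sgn !big_ord_recl !big_ord0 /= !inE.
  by case: adj; apply/orP; [left | right]; apply/eqP; lra.
have z_gram z s c i : s = [:: true] \/ s = [:: false; true] -> pattern z s ->
    gram G (r z) (r (u c i)) \in [:: -2; 0].
  move=> sE zs; have zu : z != u c i.
    by case: sE zs => -> zs; [exact: (neq_pattern _ _ _ _ o1 zs (u_pat c i) isT)
                             | exact: (neq_pattern _ _ _ _ o0 zs (u_pat c i) isT)].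
  rewrite (gram_r _ _ _ _ zs (u_pat c i)) (negPf zu).
  rewrite /sgn; case: sE => ->; rewrite !big_ord_recl !big_ord0 /= !inE;
    by case: adj; apply/orP; [left | right]; apply/eqP; lra.
have zy_gram (z : pillar B [set b1]) (x : pillar B [set b3; b4]) :
    gram G (r (sval z)) (r (sval x)) \in [:: -(4 / 3); 2 / 3].
  have zx := neq_pattern _ _ _ _ o0 (pat1 z) (pat34 x) isT.
  rewrite (gram_r _ _ _ _ (pat1 z) (pat34 x)) (negPf zx).
  rewrite /sgn !big_ord_recl !big_ord0 /= !inE.
  by case: adj; apply/orP; [left | right]; apply/eqP; lra.
(* The product is 1 - 7/3 in case (I). In case (II) it is 1 - 5/3 or -1 - 5/3, negative whether or
   not the vertices are adjacent. *)
have [z [z' [s' [s'E z's' zz']]]] : exists (z : pillar B [set b1]) z' s',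
    [/\ s' = [:: true] \/ s' = [:: false; true], pattern z' s'
      & gram G (r (sval z)) (r z') < 0].
  case: hcase => [[z [z' [zz' zNz']]]|[[z _] [z' _]]].
    exists z, (sval z'), [:: true]; split; [by left | exact: pat1 |].
    rewrite (gram_r _ _ _ _ (pat1 z) (pat1 z')) (inj_eq val_inj) (negPf zz').
    rewrite [adj _ _](negPf zNz') /sgn !big_ord_recl !big_ord0 /=; lra.
  exists z, (sval z'), [:: false; true]; split; [by right | exact: pat2 |].
  have zz' := neq_pattern _ _ _ _ o0 (pat1 z) (pat2 z') isT.
  rewrite (gram_r _ _ _ _ (pat1 z) (pat2 z')) (negPf zz').
  by rewrite /sgn !big_ord_recl !big_ord0 /=; case: adj; lra.
have y_norm (x : pillar B [set b3; b4]) : gram G (r (sval x)) (r (sval x)) = 4.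
  rewrite (gram_r _ _ _ _ (pat34 x) (pat34 x)) eqxx.
  by rewrite /sgn !big_ord_recl !big_ord0 /=; lra.
apply: (@nine_planes _ _ G G_sym G_psd (r \o u false) (r \o u true)
         (r (sval y)) (r (sval y')) (r (sval z)) (r z')) => //=.
- by move=> i; rewrite u_gram !eqxx.
- by move=> i; rewrite u_gram !eqxx.
- by move=> i; rewrite u_gram eqxx.
- by move=> i j /negPf ij; rewrite !u_gram ij.
- have yy'N : sval y != sval y'.
    by apply: contraTneq yy' => /val_inj ->; rewrite adj_irr.
  rewrite (gram_r _ _ _ _ (pat34 y) (pat34 y')) (negPf yy'N) [adj _ _]yy'.
  by rewrite /sgn !big_ord_recl !big_ord0 /=; lra.
- rewrite (gram_r _ _ _ _ (pat1 z) (pat1 z)) eqxx.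
  by rewrite /sgn !big_ord_recl !big_ord0 /=; lra.
- by move=> x; rewrite [x \in _]inE mem_seq1 => /orP[] /eqP -> i; split; apply: y_gram.
- move=> x; rewrite [x \in _]inE mem_seq1 => /orP[] /eqP -> i; split.
  + by apply: z_gram (pat1 z); left.
  + by apply: z_gram (pat1 z); left.
  + exact: z_gram z's'.
  + exact: z_gram z's'.
- by move=> x; rewrite [x \in _]inE mem_seq1 => /orP[] /eqP ->; apply: zy_gram.
Qed.
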